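(* Let $\alpha,\delta\in(0,1)$, fix $\hat\alpha\in(0,1)$ with $\hat\alpha\le\alpha$, and fix a prior probability distribution $P$ over $\Theta$ that does not depend on the data. Let $D_N$ be a calibration dataset of $N\ge2$ i.i.d. samples from $\mathcal{D}$, where $N>1/\hat\alpha-1$. Then, with probability greater than $1-\delta$ over the sampling of $D_N$, simultaneously for all probability distributions $Q$ over $\Theta$ which satisfy $$\mathrm{KL}(Q\Vert P)\le (N-1)\,\mathrm{kl}\left(\frac{\lfloor (N+1)\hat\alpha\rfloor-1}{N-1}\,\Big\Vert\,\alpha\right)-\log\left(\frac{B(N)}{\delta}\right),$$ it holds that $\mathcal{L}_{\mathrm{cov}}(Q)\le\alpha$.
   Context: Setting: $\mathcal{X}$ is an input space, $\mathcal{Y}$ a label space, $\mathcal{D}$ a probability distribution on $\mathcal{X}\times\mathcal{Y}$, $\Theta=\mathbb{R}^d$ a parameter space, and $s:\mathcal{X}\times\mathcal{Y}\times\Theta\to\mathbb{R}$ a (measurable) score function, written $s(x,y;\theta)$. Prediction set: for a threshold $\tau\in\mathbb{R}$, $C(x;\tau,\theta)=\{y\in\mathcal{Y}: s(x,y;\theta)\le\tau\}$. Calibrated threshold: for a data set $D_N=\{(x_i,y_i)\}_{i=1}^N$ and $\hat\alpha\in(0,1)$ with $(N+1)\hat\alpha\ge 1$, $\tau^*(D_N,\hat\alpha;\theta)$ is the $\lceil (N+1)(1-\hat\alpha)\rceil/N$ quantile of the scores $\{s(x_i,y_i;\theta)\}_{i=1}^N$, i.e. the $\lceil (N+1)(1-\hat\alpha)\rceil$-th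 smallest of these $N$ values. Randomized miscoverage rate: for a probability distribution $Q$ on $\Theta$ (which may depend on $D_N$), $$\mathcal{L}_{\mathrm{cov}}(Q)=\mathbb{E}_{\theta\sim Q}\Big[\mathbb{P}_{(x,y)\sim\mathcal{D}}\big(y\notin C(x;\tau^*(D_N,\hat\alpha;\theta),\theta)\big)\Big],$$ where $(x,y)$ is independent of $D_N$. Divergences: $\mathrm{KL}(Q\Vert P)$ is the Kullback–Leibler divergence, and $\mathrm{kl}(p\Vert q)=p\log\frac{p}{q}+(1-p)\log\frac{1-p}{1-q}$ is the KL divergence between Bernoulli distributions with success probabilities $p$ and $q$ (convention $0\log 0=0$). With $k=\lfloor (N+1)\hat\alpha\rfloor$ and $a=\frac{k-1}{N-1}$, $B(N)=\frac{N!}{(k-1)!\,(N-k)!}a^{k-1}(1-a)^{N-k}$ (with $0^0=1$), i.e. the density at $a$ of the Beta distribution with parameters $k$ and $N+1-k$. *)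

(* Defs.v *)
From HB Require Import structures.
From mathcomp Require Import all_boot all_order all_algebra.
From mathcomp Require Import all_classical all_reals all_analysis.

Set Implicit Arguments.
Unset Strict Implicit.
Unset Printing Implicit Defensive.

Import Order.TTheory GRing.Theory Num.Theory.
Import numFieldNormedType.Exports.

Local Open Scope classical_set_scope.
Local Open Scope charge_scope.
Local Open Scope ring_scope.

(* R^d with its Borel sigma-algebra. *)
Definition paramspace (R : realType) (d : nat) :=
  g_sigma_algebraType (@open 'rV[R]_d).

Definition mutually_independent (dO dT : measure_display)
    (Omega : measurableType dO) (T : measurableType dT) (R : realType)
    (Pr : probability Omega R) (N : nat) (Z : 'I_N -> {RV Pr >-> T}) : Prop :=
  forall (J : {set 'I_N}) (A : 'I_N -> set T),
    (forall i, measurable (A i)) ->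
    Pr (\bigcap_(i in [set` J]) (Z i @^-1` A i)) =
    (\prod_(i in J) Pr (Z i @^-1` A i))%E.

(* The laws are compared on measurable sets only: outside the sigma-algebra
   the values of a measure carry no meaning. *)
Definition iid (dO dT : measure_display)
    (Omega : measurableType dO) (T : measurableType dT) (R : realType)
    (Pr : probability Omega R) (D : probability T R)
    (N : nat) (Z : 'I_N -> {RV Pr >-> T}) : Prop :=
  mutually_independent Z /\
  forall (i : 'I_N) (A : set T), measurable A -> distribution Pr (Z i) A = D A.

Definition prediction_set (X Y Theta : Type) (R : realType)
    (s : X -> Y -> Theta -> R) (x : X) (tau : R) (theta : Theta) : set Y :=
  [set y | s x y theta <= tau].

(* [nth] counts from 0, hence the predecessor. *)
Definition threshold (X Y Theta : Type) (R : realType)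
    (s : X -> Y -> Theta -> R) (N : nat) (DN : N.-tuple (X * Y)) (ahat : R)
    (theta : Theta) : R :=
  nth 0 (sort <=%R [seq s z.1 z.2 theta | z <- DN])
    (`|Num.ceil (N.+1%:R * (1 - ahat))|%N).-1.

Definition Lcov (dX dY dTh : measure_display) (X : measurableType dX)
    (Y : measurableType dY) (Theta : measurableType dTh) (R : realType)
    (D : probability (X * Y)%type R) (s : X -> Y -> Theta -> R)
    (N : nat) (DN : N.-tuple (X * Y)) (ahat : R)
    (Q : probability Theta R) : \bar R :=
  (\int[Q]_theta
     D [set z | ~ prediction_set s z.1 (threshold s DN ahat theta) theta z.2])%E.

Definition KL (dT : measure_display) (T : measurableType dT) (R : realType)
    (Q P : probability T R) : \bar R :=
  if `[< Q `<< P >]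
  then (\int[Q]_t lne (('d (charge_of_finite_measure Q) '/d P) t))%E
  else +oo%E.

(* Meant for 0 <= p <= 1 and 0 < q < 1; the convention 0 log 0 = 0 holds
   because the logarithm is multiplied by 0. *)
Definition kl (R : realType) (p q : R) : R :=
  p * ln (p / q) + (1 - p) * ln ((1 - p) / (1 - q)).

Definition kfloor (R : realType) (N : nat) (ahat : R) : nat :=
  `|Num.floor (N.+1%:R * ahat)|%N.

Definition aratio (R : realType) (N : nat) (ahat : R) : R :=
  ((kfloor N ahat)%:R - 1) / (N%:R - 1).

(* The density of the Beta(k, N + 1 - k) distribution at (k - 1) / (N - 1). *)
Definition Bconst (R : realType) (N : nat) (ahat : R) : R :=
  let k := kfloor N ahat in
  let a := aratio N ahat in
  N`!%:R / (k.-1`!%:R * (N - k)`!%:R) * a ^+ k.-1 * (1 - a) ^+ (N - k).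

(* Main.v *)
(* Write N = p + q + 1 with p = floor((N+1) ahat) - 1, and let f be the density of
   the Beta(p + 1, q + 1) distribution. For a fixed parameter the miscoverage of
   the calibrated set is stochastically dominated by this Beta law. The function
   ln f is concave; with slope -l at alpha its tangent there gives
   f x * exp (l (x - alpha)) <= f alpha, hence E[exp (l (L - alpha))] <= f alpha for
   the miscoverage L. By Fubini and Markov, with probability more than 1 - delta
   the integral of exp (l (L - alpha)) against the prior is at most f alpha / delta,
   and then the Donsker-Varadhan inequality gives, for all Q at once,
   l (E_Q[L] - alpha) <= KL(Q, P) + ln (f alpha / delta). The right-hand side is
   nonpositive exactly under the hypothesis on KL(Q, P), which settles the case
   l > 0. If l <= 0, then alpha lies between the mean and the mode of the Beta law,
   so Jensen's inequality for ln f gives f alpha >= 1 > delta: no Q satisfies the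
   hypothesis. *)
Require Import Defs.
From mathcomp Require Import all_boot all_order all_algebra.
From mathcomp Require Import all_classical all_reals all_analysis.
From mathcomp Require Import unstable measurable_realfun zify ring lra.

Set Implicit Arguments.
Unset Strict Implicit.
Unset Printing Implicit Defensive.

Import Order.TTheory GRing.Theory Num.Theory.
Import numFieldNormedType.Exports.

Local Open Scope classical_set_scope.
Local Open Scope ring_scope.

(** * The Beta distribution *)

Section beta_density.
Context {R : realType}.
Implicit Types (p q n : nat) (t x alpha : R).

(* Minus the derivative at [alpha] of [ln \o XMonemX p q]. *)
Definition tilt p q alpha : R := q%:R / (1 - alpha) - p%:R / alpha.

Lemma le_expXn n x : 0 <= x -> x ^+ n <= expR (n%:R * (x - 1)).
Proof.
move=> x0; rewrite expRM_natl; apply: lerXn2r; rewrite ?nnegrE ?expR_ge0//.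
by rewrite -[leLHS](subrKC 1) expR_ge1Dx.
Qed.

(** The tangent bound at [alpha] for the concave function [ln \o XMonemX p q], in exponentiated form
    so that the endpoints 0 and 1 need no separate treatment. Each of the ratios [x / alpha] and
    [(1 - x) / (1 - alpha)] is handled by [le_expXn]. *)
Lemma XMonemX_tilt p q alpha x : 0 < alpha < 1 -> 0 <= x <= 1 ->
  XMonemX p q x * expR (tilt p q alpha * (x - alpha)) <= XMonemX p q alpha.
Proof.
move=> /andP[a0 a1] /andP[x0 x1].
have b0 : 0 < 1 - alpha by rewrite subr_gt0.
have -> : tilt p q alpha * (x - alpha) =
    - (p%:R * (x / alpha - 1) + q%:R * ((1 - x) / (1 - alpha) - 1)).
  by rewrite /tilt; field; rewrite ?gt_eqF.
rewrite expRN ler_pdivrMr ?expR_gt0// /XMonemX expRD.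
have -> : x ^+ p * (1 - x) ^+ q = alpha ^+ p * (1 - alpha) ^+ q *
    ((x / alpha) ^+ p * ((1 - x) / (1 - alpha)) ^+ q).
  rewrite !expr_div_n; field; rewrite ?expf_neq0 ?gt_eqF//.
apply: ler_wpM2l; first by rewrite mulr_ge0// exprn_ge0// ltW.
have xa : 0 <= x / alpha by rewrite divr_ge0// ltW.
have xb : 0 <= (1 - x) / (1 - alpha) by rewrite divr_ge0 ?subr_ge0// ltW.
by apply: ler_pM; rewrite ?le_expXn ?exprn_ge0.
Qed.

Definition binomial_cdf n m t : R :=
  \sum_(i < m.+1) ('C(n, i))%:R * t ^+ i * (1 - t) ^+ (n - i).

Lemma is_derive_binomial_term n i t :
  is_derive t 1 (fun t => ('C(n, i))%:R * t ^+ i * (1 - t) ^+ (n - i))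
   ((i%:R * t ^+ i.-1 * (1 - t) ^+ (n - i) -
     (n - i)%:R * t ^+ i * (1 - t) ^+ (n - i).-1) *+ 'C(n, i)).
Proof.
have h1 : is_derive t 1 (@GRing.exp R ^~ i) (i%:R * t ^+ i.-1).
  apply: DeriveDef; first exact: exprn_derivable.
  by rewrite exp_derive /GRing.scale/= mulr1.
have h2 : is_derive t 1 (fun x : R => (1 - x) ^+ (n - i))
    (- ((n - i)%:R * (1 - t) ^+ (n - i).-1)).
  apply: DeriveDef; first exact: onemXn_derivable.
  by rewrite -derive1E derive_onemXn mulNr.
have h3 := is_deriveM (is_deriveM (is_derive_cst ('C(n, i)%:R : R) t 1) h1) h2.
apply: (is_derive_eq h3); rewrite /GRing.scale/= -[RHS]mulr_natl.
rewrite (_ : (cst _ * _) t = 'C(n, i)%:R * t ^+ i)//; ring.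
Qed.

(** The derivatives telescope: the positive part of each new term cancels what the earlier terms
    leave, and [mul_bin_left] puts the remainder back in the same form. *)
Lemma is_derive_binomial_cdf n m t : (m < n)%N ->
  is_derive t 1 (binomial_cdf n m)
    (- (m.+1 * 'C(n, m.+1))%:R * t ^+ m * (1 - t) ^+ (n - m.+1)).
Proof.
elim: m => [|m ih] mn.
  rewrite (_ : binomial_cdf n 0 = fun t => ('C(n, 0))%:R * t ^+ 0 * (1 - t) ^+ (n - 0)).
    apply: (is_derive_eq (is_derive_binomial_term n 0 t)).
    rewrite !bin0 bin1 subn0 subn1 !expr0 mul1n !mulr1n. ring.
  by apply/funext => u; rewrite /binomial_cdf big_ord_recl big_ord0 addr0.
rewrite (_ : binomial_cdf n m.+1 = binomial_cdf n m \+
    (fun t => ('C(n, m.+1))%:R * t ^+ m.+1 * (1 - t) ^+ (n - m.+1))); last first.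
  by apply/funext => u; rewrite /binomial_cdf big_ord_recr.
apply: (is_derive_eq (is_deriveD (ih (ltnW mn)) (is_derive_binomial_term n m.+1 t))).
rewrite (mul_bin_left n m.+1) [(n - m.+2)%N]subnS !natrM -[X in _ + X]mulr_natl; ring.
Qed.

(** Matches the normalising constant of the density with the coefficient in
    [is_derive_binomial_cdf]. *)
Lemma beta_funV p q :
  (beta_fun p.+1 q.+1)^-1 = (p.+1 * 'C((p + q).+1, p.+1))%:R :> R.
Proof.
have pq : (p < (p + q).+1)%N by rewrite ltnS leq_addr.
rewrite beta_fun_fact invf_div; apply: (canLR (mulfK _)).
  by rewrite pnatr_eq0 -lt0n muln_gt0 !fact_gt0.
rewrite -natrM -(bin_fact pq) subSS addKn factS; congr _%:R.
by rewrite -!mulnA mulnCA.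
Qed.

Lemma binomial_cdf1 n m : (m < n)%N -> binomial_cdf n m 1 = 0.
Proof.
move=> mn; rewrite /binomial_cdf big1// => i _.
by rewrite subrr expr0n subn_eq0 leqNgt (leq_trans (ltn_ord i) mn) mulr0.
Qed.

(** Beta-binomial duality: on [0, 1], minus the binomial distribution function is an antiderivative
    of the Beta density, and it vanishes at 1. *)
Lemma beta_prob_tail p q t : 0 <= t <= 1 ->
  beta_prob p.+1 q.+1 `]t, +oo[ = (binomial_cdf (p + q).+1 p t)%:E.
Proof.
move=> /andP[t0 t1]; have pq : (p < (p + q).+1)%N by rewrite ltnS leq_addr.
rewrite -integral_beta_pdf//.
rewrite (_ : (fun x => (beta_pdf p.+1 q.+1 x)%:E) =
  (fun x => (XMonemX p q x / beta_fun p.+1 q.+1)%:E) \_ `[0, 1]); last first.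
  apply/funext => x; rewrite /beta_pdf !patchE; case: ifPn => //.
  by rewrite mul0r.
rewrite -integral_mkcondr.
rewrite (_ : `]t, +oo[ `&` `[0, 1] = `]t, 1]%classic); last first.
  apply/seteqP; split=> x /=; rewrite !in_itv/= ?andbT.
    by move=> [-> /andP[_ ->]].
  by move=> /andP[tx ->]; rewrite tx andbT; split=> //; rewrite (le_trans t0)// ltW.
rewrite integral_itv_obnd_cbnd; last first.
  apply/measurable_EFinP/measurable_funM => //.
  exact: measurable_XMonemX.
move: t1; rewrite le_eqVlt => /predU1P[->|t1].
  by rewrite set_itv1 integral_set1 binomial_cdf1.
have dF (x : R) := is_deriveN (@is_derive_binomial_cdf (p + q).+1 p x pq).
rewrite (@continuous_FTC2 _ _ (- binomial_cdf (p + q).+1 p)%R)//.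
- by rewrite -EFinB !fctE/= binomial_cdf1// oppr0 sub0r opprK.
- apply/continuous_subspaceT => x.
  by apply: cvgM; [exact: continuous_XMonemX|exact: cvg_cst].
- split=> [x _||].
  + exact: ex_derive.
  + by apply/cvg_at_right_filter/differentiable_continuous/derivable1_diffP;
      exact: ex_derive.
  + by apply/cvg_at_left_filter/differentiable_continuous/derivable1_diffP;
      exact: ex_derive.
- move=> x _; rewrite derive1E (derive_val (is_derive := dF x)).
  by rewrite beta_funV subSS addKn !mulNr opprK [RHS]mulrC mulrA.
Qed.

Lemma beta_prob_tail0 p q t : t < 0 ->
  beta_prob p.+1 q.+1 `]t, +oo[ = 1%E :> \bar R.
Proof.
move=> t0; apply/eqP; rewrite eq_le probability_le1//= -(beta_prob01 p.+1 q.+1).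
apply: le_measure; rewrite ?inE//.
by move=> x /=; rewrite !in_itv/= andbT => /andP[x0 _]; exact: lt_le_trans x0.
Qed.

(** The integrand times the density is bounded by a constant on [0, 1], an interval of length 1. The
    bound [M] gives the integrability required to pass to the density. *)
Lemma le_integral_beta p q (f : R -> R) c : measurable_fun setT f ->
  (forall x, 0 <= f x) -> (exists M, forall x, f x <= M) ->
  (forall x, 0 <= x <= 1 -> f x * XMonemX p q x <= c) ->
  (\int[beta_prob p.+1 q.+1]_x (f x)%:E <= (c / beta_fun p.+1 q.+1)%:E)%E.
Proof.
move=> mf f0 [M fM] fc.
rewrite integral_beta_prob//; last 2 first.
- exact/measurable_EFinP.
- apply: (@le_lt_trans _ _ (\int[beta_prob p.+1 q.+1]_x M%:E)%E).
    apply: ge0_le_integral => //.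
    + by apply/measurable_EFinP/measurableT_comp.
    + by move=> x _; rewrite lee_fin ger0_norm.
  by rewrite integral_cst//= probability_setT mule1 ltry.
rewrite (_ : (fun x => _) =
  (fun x => (f x * (XMonemX p q x / beta_fun p.+1 q.+1))%:E) \_ `[0, 1]);
  last first.
  apply/funext => x; rewrite /beta_pdf !patchE; case: ifPn => //.
  by rewrite mul0r mule0.
rewrite -integral_mkcond.
apply: (@le_trans _ _ (\int[lebesgue_measure]_(x in `[0%R, 1%R])
    (c / beta_fun p.+1 q.+1)%:E)%E).
  apply: ge0_le_integral => //=.
  - by move=> x x01; rewrite lee_fin mulr_ge0 ?f0// divr_ge0 ?beta_fun_ge0 ?XMonemX_ge0.
  - apply/measurable_EFinP/measurable_funM; first exact: measurable_funTS.
    apply: measurable_funM => //; exact: measurable_XMonemX.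
  - move=> x /=; rewrite in_itv/= => x01; rewrite lee_fin mulrA.
    by rewrite ler_wpM2r ?invr_ge0 ?beta_fun_ge0 ?fc.
by rewrite integral_cst//= lebesgue_measure_itv/= lte01 sube0 mule1.
Qed.

Definition beta_density p q alpha : R := XMonemX p q alpha / beta_fun p.+1 q.+1.

Lemma beta_density_gt0 p q alpha : 0 < alpha < 1 -> 0 < beta_density p q alpha.
Proof.
move=> /andP[a0 a1]; rewrite divr_gt0 ?beta_fun_gt0//.
by rewrite mulr_gt0 ?exprn_gt0// subr_gt0.
Qed.

(** The cap at [|tilt|] is inactive on [0, 1], where [|x - alpha| <= 1]; it keeps the integrand
    bounded on the whole line. *)
Lemma beta_mgf p q alpha : 0 < alpha < 1 ->
  (\int[beta_prob p.+1 q.+1]_x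
     (expR (Num.min (tilt p q alpha * (x - alpha)) `|tilt p q alpha|))%:E <=
   (beta_density p q alpha)%:E)%E.
Proof.
move=> a01; apply: le_integral_beta.
- apply: measurableT_comp => //; apply: measurable_minr => //.
  by apply: measurable_funM => //; exact: measurable_funB.
- by move=> x; exact: expR_ge0.
- exists (expR `|tilt p q alpha|) => x.
  by rewrite ler_expR ge_min lexx orbT.
- move=> x x01; rewrite mulrC (le_trans _ (XMonemX_tilt p q a01 x01))//.
  by rewrite ler_wpM2l ?XMonemX_ge0// ler_expR ge_min lexx.
Qed.

End beta_density.

(** * The Beta density beyond the mean, and expectations under stochastic dominance *)

Section beta_density_mean.
Context {R : realType}.
Implicit Types (p q n : nat) (t x alpha : R).

(** The mean of Beta(p + 1, q + 1) in disguise: a factor [x] in the integrand raises [p] by one. *)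
Lemma beta_funSn p q : beta_fun p.+2 q.+1 =
  p.+1%:R / (p + q).+2%:R * beta_fun p.+1 q.+1 :> R.
Proof.
rewrite !beta_fun_fact addSn (factS p) (factS (p + q).+1) !natrM.
field; rewrite -natrD -(natrD _ 1) -(natrD _ 2) !pnatr_eq0 -!lt0n !fact_gt0//.
Qed.

(* Jensen's inequality for the concave function [ln \o beta_density p q], whose
   integral against the density is nonnegative, bounds it below at the mean. *)
Lemma beta_density_ge1 p q alpha : 0 < alpha < 1 -> tilt p q alpha <= 0 ->
  p.+1%:R / (p + q).+2%:R <= alpha -> 1 <= beta_density p q alpha.
Proof.
move=> a01 tilt0 mean_le.
set f := beta_density p q alpha; set l := tilt p q alpha.
have f0 : 0 < f by exact: beta_density_gt0.
(* Chosen so that [c + l * x] is [1 + y] for [y = l * (x - alpha) - ln f]; the pointwise bound is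
   then [1 + y <= expR y]. *)
pose c := 1 - ln f - l * alpha.
have B0 := @beta_fun_gt0 R p.+1 q.+1.
have pointwise x : 0 <= x <= 1 ->
    c * XMonemX p q x + l * XMonemX p.+1 q x <= beta_fun p.+1 q.+1.
  move=> x01; have X0 := @XMonemX_ge0 _ p q x x01.
  have : XMonemX p q x * expR (l * (x - alpha) - ln f) <= beta_fun p.+1 q.+1.
    rewrite expRD expRN lnK// mulrA ler_pdivrMr//.
    rewrite (le_trans (XMonemX_tilt p q a01 x01))//.
    by rewrite /f /beta_density mulrCA divff ?mulr1// gt_eqF.
  apply: le_trans; rewrite [X in l * X](_ : _ = x * XMonemX p q x); last first.
    by rewrite /XMonemX exprS mulrA.
  apply: (@le_trans _ _ (XMonemX p q x * (1 + (l * (x - alpha) - ln f)))).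
    by rewrite le_eqVlt; apply/predU1P; left; rewrite /c; ring.
  by rewrite ler_wpM2l// expR_ge1Dx.
have iX p' q' : lebesgue_measure.-integrable `[0, 1] (EFin \o @XMonemX R p' q').
  exact: integrable_XMonemX.
have intX p' q' : (\int[lebesgue_measure]_(x in `[0, 1]) @XMonemX R p' q' x)%R
    = beta_fun p'.+1 q'.+1 by rewrite Rintegral_mkcond.
have ic (h : R -> R) : continuous h ->
    lebesgue_measure.-integrable `[0, 1] (EFin \o h).
  move=> ch; apply: continuous_compact_integrable; first exact: segment_compact.
  exact: continuous_subspaceT.
have iZ k p' q' : lebesgue_measure.-integrable `[0, 1]
    (EFin \o (fun x => k * @XMonemX R p' q' x)).
  by apply: ic => x; apply: cvgM; [exact: cvg_cst|exact: continuous_XMonemX].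
have : c * beta_fun p.+1 q.+1 + l * beta_fun p.+2 q.+1 <= beta_fun p.+1 q.+1.
  rewrite -!intX -!RintegralZl// -RintegralD//.
  rewrite [leRHS](_ : _ = \int[lebesgue_measure]_(x in `[0, 1])
    (cst (beta_fun p.+1 q.+1) x)); last first.
    by rewrite Rintegral_cst//= lebesgue_measure_itv/= lte01 sube0/= mulr1 intX.
  apply: le_Rintegral => //.
  - apply: ic => x; apply: cvgD; apply: cvgM; do ?exact: cvg_cst.
      exact: continuous_XMonemX.
    exact: continuous_XMonemX.
  - by apply: ic => x; exact: cvg_cst.
(* With [m] the mean, the integrated bound reads [l * (m - alpha) <= ln f], and both factors on the
   left are nonpositive. *)
rewrite beta_funSn [l * _]mulrA -mulrDl ger_pMl// /c => h.
have : 0 <= ln f.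
  have : l * alpha <= l * (p.+1%:R / (p + q).+2%:R) by rewrite ler_wnM2l.
  move: h; move: (_ / (p + q).+2%:R) => m; lra.
by move=> lnf; rewrite -(lnK f0) -expR0 ler_expR.
Qed.

(** Layer-cake formula: the expectation of a nonnegative variable is the integral of its tail, so
    dominated tails give dominated expectations. *)
Lemma le_integral_ccdf d d' (T : measurableType d) (T' : measurableType d')
    (P : probability T R) (P' : probability T' R) (X : T -> R) (Y : T' -> R) :
  measurable_fun setT X -> measurable_fun setT Y ->
  (forall u, 0 <= X u) -> (forall u, 0 <= Y u) ->
  (forall r, P [set u | r < X u]%R <= P' [set u | r < Y u]%R)%E ->
  (\int[P]_u (X u)%:E <= \int[P']_u (Y u)%:E)%E.
Proof.
move=> mX mY X0 Y0 XY.
pose X' : {RV P >-> R} := mfun_Sub (mem_set mX).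
pose Y' : {RV P' >-> R} := mfun_Sub (mem_set mY).
have -> : (\int[P]_u (X u)%:E = 'E_P[X'])%E by rewrite unlock.
have -> : (\int[P']_u (Y u)%:E = 'E_P'[Y'])%E by rewrite unlock.
rewrite !ge0_expectation_ccdf//; apply: ge0_le_integral => //.
- by apply: measurable_funTS; exact: ccdf_measurable.
- by apply: measurable_funTS; exact: ccdf_measurable.
- move=> r _; rewrite /ccdf /distribution /pushforward/=.
  rewrite (_ : X @^-1` _ = [set u | r < X u]); last first.
    by apply/seteqP; split=> u /=; rewrite in_itv/= andbT.
  rewrite (_ : Y @^-1` _ = [set u | r < Y u])//.
  by apply/seteqP; split=> u /=; rewrite in_itv/= andbT.
Qed.
End beta_density_mean.

(** * Order statistics of the calibration scores *)

Section order_statistic.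
Context {R : realType}.

(** The first [j + 1] sorted entries are at most entry [j], so they all lie in the lower set with
    it. *)
Lemma count_lower_set (S : pred R) (s : seq R) (j : nat) :
  (forall u v, u <= v -> S v -> S u) -> (j < size s)%N ->
  S (nth 0 (sort <=%R s) j) -> (j < count S s)%N.
Proof.
move=> Sdown js Sj.
have <- : count S (sort <=%R s) = count S s.
  by apply/permP; exact: permEl (perm_sort _ _).
have js' : (j < size (sort <=%R s))%N by rewrite size_sort.
rewrite -(cat_take_drop j.+1 (sort <=%R s)) count_cat.
apply: leq_trans (leq_addr _ _).
have stake : size (take j.+1 (sort <=%R s)) = j.+1 by rewrite size_takel.
rewrite -{1}stake leq_eqVlt; apply/predU1P; left; apply/esym/eqP; rewrite -all_count.
apply/(all_nthP 0) => i; rewrite stake ltnS => ij; rewrite nth_take//.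
apply: Sdown Sj; apply: sorted_leq_nth => //.
- exact: le_trans.
- exact: sort_sorted le_total _.
- by rewrite inE (leq_ltn_trans ij).
Qed.

Lemma nth_sort_le (s : seq R) (j : nat) (v : R) : (j < size s)%N ->
  (nth 0 (sort <=%R s) j <= v) = (j < count (<= v) s)%N.
Proof.
move=> js; apply/idP/idP; first by apply: count_lower_set => // u w; exact: le_trans.
have <- : count (<= v) (sort <=%R s) = count (<= v) s.
  by apply/permP; exact: permEl (perm_sort _ _).
(* If entry [j] exceeds [v], so do all later ones, and only the first [j] entries can be counted. *)
apply: contraTT; rewrite -ltNge -leqNgt => vj.
rewrite -(cat_take_drop j (sort <=%R s)) count_cat.
rewrite (_ : count _ (drop _ _) = 0%N).
  by rewrite addn0 (leq_trans (count_size _ _))// size_takel// size_sort ltnW.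
apply/eqP; rewrite -leqn0 leqNgt -has_count -all_predC.
apply/(all_nthP 0) => i; rewrite size_drop size_sort => ij.
rewrite nth_drop /= -ltNge (lt_le_trans vj)//.
apply: sorted_leq_nth; rewrite ?inE ?size_sort ?leq_addr//.
- exact: le_trans.
- exact: sort_sorted le_total _.
- by rewrite -ltn_subRL.
Qed.

Lemma count_mktuple (T : Type) n (S : pred T) (F : 'I_n -> T) :
  count S [tuple F i | i < n] = #|[set i | S (F i)]%SET|.
Proof.
rewrite /= count_map cardsE cardE size_filter enumT.
by apply: eq_count => i; rewrite inE.
Qed.

(* A lower set of the line is an increasing union of closed half-lines. *)
Lemma measure_lower_set d (T : measurableType d)
    (mu : {measure set T -> \bar R}) (f : T -> R) (S : set R) (c : R) :
  measurable_fun setT f -> (forall u v, u <= v -> S v -> S u) -> 0 <= c ->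
  (forall v, S v -> (mu (f @^-1` `]-oo, v]) <= c%:E)%E) ->
  (mu (f @^-1` S) <= c%:E)%E.
Proof.
move=> mf Sdown c0 Sc.
have mh v : measurable (f @^-1` `]-oo, v]).
  by rewrite -[X in measurable X]setTI; exact: mf.
have union (u : nat -> R) : nondecreasing_seq u -> S = \bigcup_n `]-oo, u n]%classic ->
    (mu (f @^-1` S) <= c%:E)%E.
  move=> ndu SE.
  have cvgu : mu (f @^-1` `]-oo, u n]) @[n --> \oo] --> mu (f @^-1` S).
    rewrite SE preimage_bigcup; apply: nondecreasing_cvg_mu => //.
      exact: bigcupT_measurable.
    move=> m n /ndu umn; apply/subsetPset => x /=; rewrite !in_itv/= => fx.
    exact: le_trans umn.
  rewrite -(cvg_lim _ cvgu)//; apply: lime_le.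
    by apply/cvg_ex; eexists; exact: cvgu.
  by apply: nearW => n; apply: Sc; rewrite SE; exists n => //=; rewrite in_itv/=.
(* Four cases: [S] empty; unbounded, exhausted by half-lines ending at [n]; with attained supremum,
   a single half-line; otherwise exhausted by half-lines ending at [sup S - 1 / (n + 1)]. *)
have [->|/set0P[v0 Sv0]] := eqVneq S set0.
  by rewrite preimage_set0 measure0 lee_fin.
have [ubS|ubS] := pselect (has_ubound S); last first.
  apply: (union (fun n => n%:R)); first by move=> m n mn; rewrite ler_nat.
  apply/seteqP; split=> x _ /=.
    exists (Num.truncn `|x|).+1 => //=; rewrite in_itv/=.
    by rewrite (le_trans (ler_norm x))// ltW// truncnS_gt.
  apply: contrapT => Sx; apply: ubS; exists x => y Sy.
  by rewrite leNgt; apply/negP => /ltW xy; exact/Sx/(Sdown _ _ xy).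
have supS : has_sup S by split => //; exists v0.
have Sle v : S v -> v <= sup S by exact: ub_le_sup.
have [Ssup|Ssup] := pselect (S (sup S)).
  rewrite (_ : S = `]-oo, sup S]%classic); first exact: Sc.
  apply/seteqP; split=> x /=; rewrite in_itv/=; first exact: Sle.
  by move=> /Sdown; apply.
apply: (union (fun n => sup S - n.+1%:R^-1)).
  move=> m n mn; rewrite lerD2l lerN2 lef_pV2 ?posrE// ler_nat.
  by rewrite ltnS.
apply/seteqP; split=> x /=.
  move=> Sx; have xs : 0 < sup S - x.
    by rewrite subr_gt0 lt_neqAle Sle// andbT; apply/eqP => xE; rewrite -xE in Ssup.
  exists (Num.truncn (sup S - x)^-1) => //=; rewrite in_itv/= lerBrDr -lerBrDl.
  by rewrite invf_ple ?posrE// ltW// truncnS_gt.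
move=> [n _]; rewrite /= in_itv/= => xn.
have n0 : 0 < n.+1%:R^-1 :> R by [].
have [y Sy ny] := sup_adherent n0 supS.
exact/(Sdown _ _ _ Sy)/(le_trans xn)/ltW.
Qed.

Lemma sum_card_binomial_cdf N m (t : R) :
  \sum_(J : {set 'I_N} | (#|J| <= m)%N) t ^+ #|J| * (1 - t) ^+ (N - #|J|) =
  binomial_cdf N m t.
Proof.
rewrite (partition_big (fun J : {set 'I_N} => inord #|J| : 'I_m.+1) xpredT)//=.
rewrite /binomial_cdf; apply: eq_bigr => i _.
rewrite (eq_bigl (fun J : {set 'I_N} => #|J| == i)); last first.
  move=> J; apply/andP/eqP => [[Jm /eqP <-]|Ji]; first by rewrite inordK.
  by rewrite Ji -ltnS ltn_ord inord_val eqxx.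
rewrite (eq_bigr (fun=> t ^+ i * (1 - t) ^+ (N - i))); last by move=> J /eqP ->.
rewrite big_const iter_addr_0 -[LHS]mulr_natl mulrA; congr (_%:R * _ * _).
have := card_draws 'I_N i; rewrite card_ord => <-.
by apply: eq_card => J; rewrite !inE.
Qed.

(** * The number of i.i.d. samples that fall in a given set *)

Section iid_count.
Context (dO dT : measure_display) (Omega : measurableType dO)
  (T : measurableType dT) (Pr : probability Omega R) (D : probability T R)
  (N : nat) (Z : 'I_N -> {RV Pr >-> T}).
Hypothesis hZ : iid D Z.
Variables (A : set T) (mA : measurable A).

(** The samples falling in [A] are exactly those indexed by [J]. The intersection runs over all
    indices, so that independence applies with a family of sets varying with the index. *)
Let event (J : {set 'I_N}) :=
  \bigcap_(i in [set` [set: 'I_N]%SET]) (Z i @^-1` (if i \in J then A else ~` A)).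

Let mevent J : measurable (event J).
Proof.
apply: fin_bigcap_measurable; first exact: finite_finpred.
move=> i _; rewrite -[X in measurable X]setTI; apply: measurable_funP => //.
by case: ifP => // _; exact: measurableC.
Qed.

Let eventE J w : event J w -> J = [set i | `[< A (Z i w) >]]%SET.
Proof.
move=> Jw; apply/setP => i; rewrite inE; have := Jw i; rewrite /= inE => /(_ isT).
by case: ifP => _ h; apply/esym; [exact/asboolP|exact/asboolPn].
Qed.

Let countE m : [set w | (#|[set i | `[< A (Z i w) >]]%SET| <= m)%N] =
  \bigcup_(J in [set` [pred J : {set 'I_N} | (#|J| <= m)%N]]) event J.
Proof.
apply/seteqP; split=> w /=.
  move=> wm; exists [set i | `[< A (Z i w) >]]%SET => //.
  move=> i _ /=; rewrite inE; case: ifP => [/asboolP//|/negbT /asboolPn//].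
by move=> [J /= Jm /eventE <-].
Qed.

Lemma measurable_iid_count m :
  measurable [set w | (#|[set i | `[< A (Z i w) >]]%SET| <= m)%N].
Proof.
by rewrite countE; apply: fin_bigcup_measurable => //; exact: finite_finset.
Qed.

(** Sums over the disjoint patterns [event J]; by independence each has probability
    [t ^+ #|J| * (1 - t) ^+ (N - #|J|)] with [t] the mass of [A]. *)
Lemma iid_count m :
  Pr [set w | (#|[set i | `[< A (Z i w) >]]%SET| <= m)%N] =
  (binomial_cdf N m (fine (D A)))%:E.
Proof.
rewrite countE measure_fin_bigcup//; last first.
  by move=> J J' _ _ [w [/eventE -> /eventE ->]].
rewrite -(@bigfs _ _ _ _ (index_enum {set 'I_N})) ?index_enum_uniq//; last first.
  by move=> J _; rewrite mem_index_enum.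
rewrite -sum_card_binomial_cdf -sumEFin; apply: eq_bigr => J _.
transitivity (\prod_(i in [set: 'I_N]%SET)
    Pr (Z i @^-1` (if i \in J then A else ~` A)))%E.
  apply: (hZ.1 [set: 'I_N]%SET (fun i => if i \in J then A else ~` A)).
  by move=> i; case: ifP => // _; exact: measurableC.
rewrite (eq_bigr
  (fun i => (if i \in J then fine (D A) else 1 - fine (D A))%:E)); last first.
  move=> i _; transitivity (D (if i \in J then A else ~` A)).
    by apply: hZ.2; case: ifP => // _; exact: measurableC.
  case: ifP => _; first by rewrite fineK// fin_num_measure.
  by rewrite probability_setC// EFinB fineK// fin_num_measure.
rewrite -(big_morph EFin (@EFinM R) (erefl _)); congr EFin.
rewrite (eq_bigl xpredT); last by move=> i; rewrite inE.
rewrite (bigID (mem J))/=; congr (_ * _).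
  by rewrite (eq_bigr (fun=> fine (D A))) ?big_const ?iter_mulr_1// => i ->.
rewrite (eq_bigr (fun=> 1 - fine (D A))); last by move=> i /negbTE ->.
rewrite big_const iter_mulr_1; congr (_ ^+ _).
have /(congr1 (subn^~ #|J|)) := cardsC J; rewrite /= card_ord addKn => <-.
by apply: eq_card => i; rewrite !inE.
Qed.

End iid_count.

End order_statistic.

(** * Measurability and tail bound of the miscoverage at a fixed parameter *)

Section order_statistic_measurable.
Context {R : realType}.

Lemma measurable_set_lt d (T : measurableType d) (f g : T -> R) :
  measurable_fun setT f -> measurable_fun setT g ->
  measurable [set x | f x < g x].
Proof.
move=> mf mg;
have h := measurable_fun_ltr mf mg measurableT (I : measurable [set true]).
rewrite setTI in h; exact: h.
Qed.

Lemma measurable_set_le d (T : measurableType d) (f g : T -> R) :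
  measurable_fun setT f -> measurable_fun setT g ->
  measurable [set x | f x <= g x].
Proof.
move=> mf mg;
have h := measurable_fun_ler mf mg measurableT (I : measurable [set true]).
rewrite setTI in h; exact: h.
Qed.

Lemma measurable_nth_sort dU (U : measurableType dU) N (V : 'I_N -> U -> R) j :
  (j < N)%N -> (forall i, measurable_fun setT (V i)) ->
  measurable_fun setT (fun u => nth 0 (sort <=%R [tuple V i u | i < N]) j).
Proof.
move=> jN mV; apply: (measurability _ (RGenOInfty.measurableE R)).
move=> _ [_ [x ->] <-]; rewrite setTI.
have sizeV u : (j < size [seq V i u | i <- enum 'I_N])%N.
  by rewrite size_map size_enum_ord.
(* The order statistic exceeds [x] exactly when no set of more than [j] indices has all its values
   at most [x]. *)
rewrite (_ : _ @^-1` _ =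
    ~` \bigcup_(J in [set J : {set 'I_N} | (j < #|J|)%N])
       \bigcap_(i in [set` J]) [set u | V i u <= x]); last first.
  apply/seteqP; split=> u /=.
    rewrite in_itv/= andbT ltNge nth_sort_le ?sizeV// => /negP h [J /= jJ uJ]; apply: h.
    rewrite count_mktuple (leq_trans jJ)// subset_leq_card//.
    by apply/fintype.subsetP => i iJ; rewrite inE; exact: uJ.
  rewrite in_itv/= andbT ltNge nth_sort_le ?sizeV// => h; apply/negP => ju; apply: h.
  exists [set i | V i u <= x]%SET; first by have /= <- := count_mktuple (<= x) (V ^~ u).
  by move=> i; rewrite /= inE.
apply: measurableC; apply: fin_bigcup_measurable; first exact: finite_finset.
move=> J _; apply: fin_bigcap_measurable; first exact: finite_finset.
by move=> i _; exact: measurable_set_le.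
Qed.

Lemma measurable_tail_prob dU dT (U : measurableType dU) (T : measurableType dT)
    (D : probability T R) (tau : U -> R) (g : U * T -> R) :
  measurable_fun setT tau -> measurable_fun setT g ->
  measurable_fun setT (fun u => D [set z | tau u < g (u, z)]).
Proof.
move=> mtau mg.
have mA : measurable [set uz : U * T | tau uz.1 < g uz].
  by apply: measurable_set_lt => //; exact: measurableT_comp.
rewrite (_ : (fun u => _) = D \o xsection [set uz : U * T | tau uz.1 < g uz]).
  exact: measurable_fun_xsection.
apply/funext => u /=; congr (D _); rewrite /xsection.
by apply/seteqP; split=> z /=; rewrite inE.
Qed.

Context (dO dT : measure_display) (Omega : measurableType dO)
  (T : measurableType dT) (Pr : probability Omega R) (D : probability T R)
  (p q : nat) (Z : 'I_(p + q).+1 -> {RV Pr >-> T}).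
Hypothesis hZ : iid D Z.
Variables (sc : T -> R) (msc : measurable_fun setT sc).

(** With [N = p + q + 1] and [k = p + 1], position [q] counted from 0 is the [(N + 1 - k)]-th
    smallest score, which is the calibrated threshold. *)
Definition miscoverage w : R :=
  fine (D [set z | nth 0 (sort <=%R [tuple sc (Z i w) | i < (p + q).+1]) q < sc z]).

Lemma measurable_miscoverage : measurable_fun setT miscoverage.
Proof.
apply: measurableT_comp => //.
apply: (measurable_tail_prob D (g := sc \o snd)); last exact: measurableT_comp.
apply: measurable_nth_sort; first by rewrite ltnS leq_addl.
by move=> i; apply: measurableT_comp.
Qed.

Lemma miscoverage_itv w : 0 <= miscoverage w <= 1.
Proof.
have mlt : measurable
    [set z | nth 0 (sort <=%R [tuple sc (Z i w) | i < (p + q).+1]) q < sc z].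
  exact: measurable_set_lt.
rewrite fine_ge0 ?measure_ge0//= -lee_fin fineK ?fin_num_measure//.
exact: probability_le1.
Qed.

(* The scores at which the miscoverage exceeds [t] form a lower set of
   probability at most [1 - t], and the miscoverage exceeds [t] only if at most
   [p] of the calibration scores fall outside it. *)
Lemma miscoverage_tail t :
  (Pr [set w | (t < miscoverage w)%R] <= beta_prob p.+1 q.+1 `]t, +oo[)%E.
Proof.
have mtail u : measurable [set w | u < miscoverage w].
  exact/measurable_set_lt/measurable_miscoverage.
have mle v : measurable [set z | sc z <= v] by exact: measurable_set_le.
have mlt v : measurable [set z | v < sc z] by exact: measurable_set_lt.
have [t0|t0] := ltP t 0; first by rewrite beta_prob_tail0// probability_le1.
have [t1|t1] := ltP t 1; last first.
  rewrite (_ : [set w | _] = set0) ?measure0//.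
  apply/seteqP; split=> w //=; apply/negP; rewrite -leNgt (le_trans _ t1)//.
  by rewrite -lee_fin fineK ?fin_num_measure// probability_le1.
(* The miscoverage exceeds [t] exactly when the threshold lies in [S]. *)
pose S v := t < fine (D [set z | v < sc z]).
have Sdown u v : u <= v -> S v -> S u.
  move=> uv Sv; rewrite /S (lt_le_trans Sv)// fine_le ?fin_num_measure//.
  by apply: le_measure; rewrite ?inE// => z /=; exact: le_lt_trans.
have mS : measurable (sc @^-1` [set v | S v]).
  rewrite -[X in measurable X]setTI; apply: msc => //.
  apply: is_interval_measurable => u v _ Sv x /andP[_ xv]; exact: Sdown xv Sv.
have DS : (D (sc @^-1` [set v | S v]) <= (1 - t)%:E)%E.
  apply: measure_lower_set => //; first by rewrite subr_ge0 ltW.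
  move=> v Sv.
  have -> : sc @^-1` `]-oo, v] = ~` [set z | v < sc z].
    by apply/seteqP; split=> z /=; rewrite in_itv/= leNgt => /negP.
  suff : (D (~` [set z | (v < sc z)%R]) <= (1 - t)%:E)%E by [].
  rewrite probability_setC// -[X in (1 - X)%E]fineK ?fin_num_measure//.
  by rewrite -EFinB lee_fin lerD2l lerN2 ltW.
pose A := sc @^-1` ~` [set v | S v].
have mA : measurable A by rewrite /A preimage_setC; exact: measurableC.
have tA : t <= fine (D A).
  rewrite -lee_fin fineK ?fin_num_measure// /A preimage_setC probability_setC//.
  rewrite -(fineK (fin_num_measure D _ mS)) -EFinB lee_fin lerBrDl addrC -lerBrDl.
  by rewrite -lee_fin fineK ?fin_num_measure.
have A1 : fine (D A) <= 1 by rewrite -lee_fin fineK ?fin_num_measure// probability_le1.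
(* Atoms of the score law can push the mass of [A] above [t]. The Beta tail at that mass is smaller
   than at [t], and it is an exact binomial probability. *)
apply: (@le_trans _ _ (beta_prob p.+1 q.+1 `]fine (D A), +oo[)); last first.
  apply: le_measure; rewrite ?inE//; apply: subset_itvr; rewrite bnd_simp//.
rewrite beta_prob_tail; last by rewrite A1 (le_trans t0).
rewrite -(iid_count hZ mA); apply: le_measure; rewrite ?inE//.
  exact: measurable_iid_count.
move=> w wt /=.
(* The threshold lies in [S], hence so do at least [q + 1] of the [p + q + 1] scores, leaving at
   most [p] in [A]. *)
have : (q < #|[set i | S (sc (Z i w))]%SET|)%N.
  rewrite -(count_mktuple S (fun i => sc (Z i w))).
  by apply: count_lower_set Sdown _ wt; rewrite size_tuple ltnS leq_addl.
have -> : [set i | `[< A (Z i w) >]]%SET = (~: [set i | S (sc (Z i w))])%SET.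
  by apply/setP => i; rewrite !inE; apply/asboolP/negP.
have := cardsC [set i | S (sc (Z i w))]%SET; rewrite card_ord.
move: #|_| #|_| => a b ab qa.
lia.
Qed.

End order_statistic_measurable.

(** * Change of measure *)

Section change_of_measure.
Context {R : realType}.
Local Open Scope ereal_scope.
Local Open Scope charge_scope.

(** Comparing positive and negative parts separately avoids integrability assumptions, so the bound
    applies to the logarithm of a density. *)
Lemma ae_le_integral d (T : measurableType d) (mu : {measure set T -> \bar R})
    (h f : T -> \bar R) :
  measurable_fun setT h -> measurable_fun setT f ->
  {ae mu, forall x, h x <= f x} ->
  \int[mu]_x h x <= \int[mu]_x f x.
Proof.
move=> mh mf hf; rewrite integralE [leRHS]integralE; apply: leeB.
- apply: ae_ge0_le_integral => //.
  + exact: measurable_funepos.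
  + exact: measurable_funepos.
  + by apply: filterS hf => x hfx _; rewrite !funeposE le_max2.
- apply: ae_ge0_le_integral => //.
  + exact: measurable_funeneg.
  + exact: measurable_funeneg.
  + by apply: filterS hf => x hfx _; rewrite !funenegE le_max2// leeN2.
Qed.

Section Radon_Nikodym_probability.
Context d (T : measurableType d) (Q P : probability T R).
Hypothesis QP : Q `<< P.

Let r := ('d (charge_of_finite_measure Q) '/d P).
Let fr x := fine (r x).

Let rE x : r x = (fr x)%:E.
Proof. by rewrite /fr fineK//; exact: Radon_Nikodym_fin_num. Qed.

Let mfr : measurable_fun setT fr.
Proof.
apply: measurableT_comp => //.
exact/measurable_int/Radon_Nikodym_integrable.
Qed.

Lemma measurable_lne_Radon_Nikodym : measurable_fun setT (fun x => lne (r x)).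
Proof.
rewrite (_ : (fun x => _) = (fun x => if (fr x <= 0)%R then -oo else (ln (fr x))%:E)).
  apply: measurable_fun_ifT => //; first exact: measurable_fun_ler.
  by apply/measurable_EFinP/measurableT_comp.
by apply/funext => x; rewrite rE.
Qed.

(** The set where the density is nonpositive has as its [Q]-mass the integral of the density over
    it, which is at most 0. *)
Lemma Radon_Nikodym_gt0 : {ae Q, forall x, (0 < fr x)%R}.
Proof.
have mr0 : measurable [set x | (fr x <= 0)%R] by exact: measurable_set_le.
exists [set x | (fr x <= 0)%R]; split => //.
  apply/eqP; rewrite eq_le measure_ge0 andbT.
  have -> : Q [set x | (fr x <= 0)%R] = \int[P]_(x in [set x | (fr x <= 0)%R]) r x.
    exact: (@Radon_Nikodym_integral _ _ _ (charge_of_finite_measure Q) P _ QP mr0).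
  rewrite integralE (eq_integral (cst 0)); last first.
    by apply: le0_funeposE => x /=; rewrite rE lee_fin.
  by rewrite integral0 sub0e oppe_le0 integral_ge0.
by move=> x /= /negP; rewrite -leNgt.
Qed.

(** Dividing by the density turns [Q] back into [P]; only an inequality results, since [P] may
    charge the zeros of the density. *)
Lemma integral_expR_sub_ln_Radon_Nikodym (g : T -> R) : measurable_fun setT g ->
  \int[Q]_x (expR (g x - ln (fr x)))%:E <= \int[P]_x (expR (g x))%:E.
Proof.
move=> mg.
have mk : measurable_fun setT (fun x => (expR (g x - ln (fr x)))%:E).
  apply/measurable_EFinP/measurableT_comp => //.
  by apply: measurable_funB => //; exact: measurableT_comp.
rewrite -(Radon_Nikodym_SigmaFinite.change_of_variables QP)//.
have mfs := measurable_int _ (Radon_Nikodym_SigmaFinite.f_integrable QP).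
apply: ae_ge0_le_integral => //.
- move=> x _; rewrite mule_ge0 ?lee_fin ?expR_ge0//.
  exact: Radon_Nikodym_SigmaFinite.f_ge0.
- exact: emeasurable_funM.

- by apply/measurable_EFinP/measurableT_comp.
(* The density in the change of variables and the one in [KL] agree [P]-almost everywhere. *)
- have := ae_eq_Radon_Nikodym_SigmaFinite QP measurableT.
  apply: filterS => x fE _; rewrite fE// -/r rE -EFinM lee_fin.
  have [fr0|fr0] := leP (fr x) 0%R.
    by rewrite (le_trans (mulr_ge0_le0 _ fr0)) ?expR_ge0.
  by rewrite expRD expRN lnK ?posrE// divfK// gt_eqF.
Qed.

End Radon_Nikodym_probability.

(* Integrates against [Q] the bound
   [1 + (g - ln r - ln W) <= expR (g - ln r) / W], where [r] is the density. *)
Lemma donsker_varadhan d (T : measurableType d) (Q P : probability T R)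
    (g : T -> R) (W : R) :
  measurable_fun setT g -> Q.-integrable setT (EFin \o g) -> (0 < W)%R ->
  \int[P]_x (expR (g x))%:E <= W%:E ->
  \int[Q]_x (g x)%:E - (ln W)%:E <= KL Q P.
Proof.
move=> mg ig W0 PW; rewrite /KL; case: ifPn => [/asboolP QP|_]; last by rewrite leey.
set r := 'd _ '/d _; pose fr x := fine (r x).
have rE x : r x = (fr x)%:E by rewrite /fr fineK//; exact: Radon_Nikodym_fin_num.
have mfr : measurable_fun setT fr.
  by apply: measurableT_comp => //; exact/measurable_int/Radon_Nikodym_integrable.
pose k x := expR (g x - ln (fr x)).
have mk : measurable_fun setT k.
  apply: measurableT_comp => //.
  by apply: measurable_funB => //; exact: measurableT_comp.
have kW : \int[Q]_x (k x)%:E <= W%:E.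
  exact: le_trans (integral_expR_sub_ln_Radon_Nikodym QP mg) PW.
have ik : Q.-integrable setT (EFin \o k).
  apply/integrableP; split; first exact/measurable_EFinP.
  under eq_integral do rewrite /= ger0_norm ?expR_ge0//.
  by rewrite (le_lt_trans kW)// ltry.
(* The pointwise bound rearranges to [a - b <= ln r], and [b] has integral at most 1, which absorbs
   the 1 in [a]. *)
pose a x := (g x + (1 - ln W))%R; pose b x := (W^-1 * k x)%R.
have ia : Q.-integrable setT (EFin \o a).
  rewrite (_ : EFin \o a = (EFin \o g) \+ (EFin \o cst (1 - ln W)%R))//.
  by apply: integrableD => //; exact: finite_measure_integrable_cst.
have ib : Q.-integrable setT (EFin \o b).
  rewrite (_ : EFin \o b = fun x => (W^-1)%:E * (EFin \o k) x)//.
  exact: integrableZl.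
apply: (@le_trans _ _ (\int[Q]_x ((a x)%:E - (b x)%:E))).
  rewrite integralB_EFin//.
  have -> : \int[Q]_x (a x)%:E = \int[Q]_x (g x)%:E + (1 - ln W)%:E.
    rewrite (_ : (fun x => _) = (fun x => (g x)%:E + (cst (1 - ln W)%R x)%:E))//.
    rewrite integralD_EFin//; last exact: finite_measure_integrable_cst.
    congr (_ + _); rewrite -[LHS]/(\int[Q]_x (cst (1 - ln W)%:E x)).
    by rewrite integral_cst//= probability_setT mule1.
  have -> : \int[Q]_x (b x)%:E = (W^-1)%:E * \int[Q]_x (k x)%:E.
    rewrite (_ : (fun x => _) = (fun x => (W^-1)%:E * (k x)%:E))//.
    by rewrite integralZl.
  move: kW; rewrite -(fineK (integrable_fin_num _ ig))//.
  rewrite -(fineK (integrable_fin_num _ ik))//.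
  move: (fine _) (fine _) => u v; rewrite lee_fin => uW.
  rewrite -EFinM -EFinD -!EFinB lee_fin.
  have : (W^-1 * v <= 1)%R by rewrite mulrC ler_pdivrMr// mul1r.
  lra.
apply: ae_le_integral.
- apply: emeasurable_funB; apply/measurable_EFinP.
  + exact: measurable_funD.
  + exact: measurable_funM.
- exact: measurable_lne_Radon_Nikodym.
have := Radon_Nikodym_gt0 QP; apply: filterS => x fr0; rewrite rE lne_EFin//.
rewrite -EFinB lee_fin /a /b /k.
have := expR_ge1Dx (g x - ln (fr x) - ln W).
rewrite [expR (_ - ln W)]expRD expRN lnK ?posrE// [X in (_ <= X)%R]mulrC.
lra.
Qed.

End change_of_measure.

(** * The PAC-Bayes bound *)

Section pac_bayes.
Context {R : realType}.

(** If Markov's inequality were an equality, the excess of [W] over [c] would integrate to 0, so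
    [W <= c] almost surely, against [0 < delta]. Strictness yields probability greater than
    [1 - delta]. *)
Lemma markov_strict d (T : measurableType d) (Pr : probability T R)
    (W : T -> R) (c delta : R) : measurable_fun setT W -> (forall x, 0 <= W x) ->
  0 < c -> 0 < delta -> (\int[Pr]_x (W x)%:E <= (c * delta)%:E)%E ->
  (Pr [set x | c < W x]%R < delta%:E)%E.
Proof.
move=> mW W0 c0 d0 intW; rewrite ltNge; apply/negP => dA.
set A := [set x | c < W x] in dA.
have mA : measurable A by exact: measurable_set_lt.
pose h x := Num.max (W x - c) 0.
have mh : measurable_fun setT (EFin \o h).
  by apply/measurable_EFinP/measurable_maxr => //; exact: measurable_funB.
have h0 x : (0 <= (h x)%:E)%E by rewrite lee_fin le_max lexx orbT.
have : (c%:E * Pr A + \int[Pr]_x (h x)%:E <= (c * delta)%:E)%E.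
  apply: le_trans intW.
  rewrite -[X in (_ * Pr X)%E]setIT -integral_indic// -ge0_integralZl//; last 2 first.
  - exact/measurable_EFinP.
  - by rewrite lee_fin ltW.
  rewrite -ge0_integralD//; last 2 first.
  - by move=> x _; rewrite -EFinM lee_fin mulr_ge0// ltW.
  - by apply/measurable_EFinP; apply: measurable_funM.
  apply: ge0_le_integral => //.
  - by move=> x _; rewrite adde_ge0// -EFinM lee_fin mulr_ge0// ltW.
  - by apply: emeasurable_funD => //; apply/measurable_EFinP/measurable_funM.
  - exact/measurable_EFinP.
  move=> x _; rewrite -EFinM -EFinD lee_fin indicE /h.
  have [xA|xA] := boolP (x \in A).
    move: xA; rewrite inE /A/= => cW.
    by rewrite mulr1 max_l ?subr_ge0 ?(ltW cW)// subrKC.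
  move: xA; rewrite notin_setE /A/= => /negP; rewrite -leNgt => Wc.
  by rewrite mulr0 add0r ge_max W0 andbT; rewrite (le_trans _ (W0 x))// subr_le0.
have cA : ((c * delta)%:E <= c%:E * Pr A)%E by rewrite EFinM lee_pmul2l// lte_fin.
move=> le_cd.
have inth : (\int[Pr]_x (h x)%:E = 0)%E.
  apply/eqP; rewrite eq_le integral_ge0// andbT.
  have := le_trans (leeD2r _ cA) le_cd.
  by rewrite -[leRHS]adde0 leeD2lE.
have /(ae_eq_integral_abs Pr measurableT mh) : (\int[Pr]_x `|(EFin \o h) x| = 0)%E.
  by rewrite -[RHS]inth; apply: eq_integral => x _; exact: gee0_abs (h0 x).
move=> [N [mN N0 hN]].
suff : (Pr A <= 0)%E by apply/negP; rewrite -ltNge (lt_le_trans _ dA).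
rewrite -N0 le_measure ?inE//; apply: subset_trans hN => x; rewrite /A/= => cW.
move=> /(_ Logic.I) /eqP; rewrite eqe /h max_l ?subr_ge0 ?(ltW cW)//.
by rewrite subr_eq0 gt_eqF.
Qed.

(** For a positive tilt the exponential is increasing, so the tail domination of [miscoverage_tail]
    carries over to it. *)
Lemma miscoverage_mgf (dO dT : measure_display) (Omega : measurableType dO)
    (T : measurableType dT) (Pr : probability Omega R) (D : probability T R)
    (p q : nat) (Z : 'I_(p + q).+1 -> {RV Pr >-> T}) (sc : T -> R) (alpha : R) :
  iid D Z -> measurable_fun setT sc -> 0 < alpha < 1 -> 0 < tilt p q alpha ->
  (\int[Pr]_w (expR (tilt p q alpha * (miscoverage D Z sc w - alpha)))%:E <=
   (beta_density p q alpha)%:E)%E.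
Proof.
move=> hZ msc a01 l0; set l := tilt p q alpha.
apply: le_trans (beta_mgf p q a01); rewrite -/l.
have mM := measurable_miscoverage D Z msc.
have mg : measurable_fun setT (fun w => expR (l * (miscoverage D Z sc w - alpha))).
  apply: measurableT_comp => //; apply: measurable_funM => //.
  exact: measurable_funB.
have mf : measurable_fun setT (fun x : R => expR (Num.min (l * (x - alpha)) `|l|)).
  apply: measurableT_comp => //; apply: measurable_minr => //.
  by apply: measurable_funM => //; exact: measurable_funB.
apply: le_integral_ccdf => //; do ?by move=> ?; rewrite expR_ge0.
move=> r; have [r0|r0] := leP r 0.
  rewrite [X in (_ <= _ X)%E](_ : _ = setT); last first.
    by apply/seteqP; split=> // x _ /=; rewrite (le_lt_trans r0) ?expR_gt0.
  by rewrite [leRHS]probability_setT probability_le1//; exact: measurable_set_lt.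
have rE y : (r < expR y) = (ln r < y) by rewrite -[in LHS](lnK r0) ltr_expR.
have tailE w : (r < expR (l * (miscoverage D Z sc w - alpha))) =
    (alpha + ln r / l < miscoverage D Z sc w).
  by rewrite rE -ltrBDl ltr_pdivrMr// mulrC.
(* Levels from [expR l] on are never exceeded, as the miscoverage is at most 1; below them the cap
   in [beta_mgf] does not affect the event. *)
have [lr|rl] := leP l (ln r).
  rewrite (_ : [set u | _] = set0) ?measure0//.
  apply/seteqP; split=> w //=; rewrite tailE; apply/negP; rewrite -leNgt.
  have /andP[_ M1] := miscoverage_itv D Z msc w; apply: (le_trans M1).
  have : 1 <= ln r / l by rewrite ler_pdivlMr// mul1r.
  by case/andP: a01 => a0 _; lra.
under eq_set do rewrite tailE.
apply: (le_trans (miscoverage_tail hZ msc _)).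
apply: le_measure; rewrite ?inE//.
  exact: measurable_set_lt.
move=> x /=; rewrite in_itv/= andbT => tx.
by rewrite rE lt_min (gtr0_norm l0) rl andbT mulrC -ltr_pdivrMr// ltrBrDl.
Qed.

Context (dX dY dO dTh : measure_display) (X : measurableType dX)
  (Y : measurableType dY) (Theta : measurableType dTh)
  (D : probability (X * Y)%type R) (s : X -> Y -> Theta -> R).
Hypothesis ms : measurable_fun [set: (X * Y) * Theta] (fun u => s u.1.1 u.1.2 u.2).
Context (P : probability Theta R) (Omega : measurableType dO)
  (Pr : probability Omega R) (p q : nat)
  (Z : 'I_(p + q).+1 -> {RV Pr >-> (X * Y)%type}).
Hypothesis hZ : iid D Z.

Let score theta (z : X * Y) := s z.1 z.2 theta.
Let M w theta := miscoverage D Z (score theta) w.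

Let mscore theta : measurable_fun setT (score theta).
Proof.
have mpair : measurable_fun setT (fun z : X * Y => (z, theta)).
  exact/measurable_fun_pair.
exact: measurableT_comp ms mpair.
Qed.

Let mM : measurable_fun setT (fun u : Omega * Theta => M u.1 u.2).
Proof.
apply: measurableT_comp => //.
apply: (measurable_tail_prob D
  (g := fun v : (Omega * Theta) * (X * Y) => s v.2.1 v.2.2 v.1.2)).
  apply: measurable_nth_sort; first by rewrite ltnS leq_addl.
  move=> i.
  have mpair : measurable_fun setT (fun u : Omega * Theta => (Z i u.1, u.2)).
    by apply/measurable_fun_pair => //; exact: measurableT_comp.
  exact: measurableT_comp ms mpair.
have mpair : measurable_fun setT (fun v : (Omega * Theta) * (X * Y) => (v.2, v.1.2)).
  by apply/measurable_fun_pair => //; exact: measurableT_comp.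
exact: measurableT_comp ms mpair.
Qed.

(** The event involves only the average over the prior, so it is fixed before [Q] and serves all [Q]
    at once. *)
Lemma pac_bayes alpha delta :
  0 < alpha < 1 -> 0 < delta -> 0 < tilt p q alpha ->
  exists E : set Omega,
    [/\ measurable E, ((1 - delta)%:E < Pr E)%E &
      forall w, E w -> forall Q : probability Theta R,
        (KL Q P <= (ln (delta / beta_density p q alpha))%:E)%E ->
        (\int[Q]_theta (M w theta)%:E <= alpha%:E)%E].
Proof.
move=> a01 d0 l0; set l := tilt p q alpha in l0; set f := beta_density p q alpha.
have f0 : 0 < f by exact: beta_density_gt0.
pose G w theta := expR (l * (M w theta - alpha)).
have mG : measurable_fun setT (fun u : Omega * Theta => (G u.1 u.2)%:E).
  apply/measurable_EFinP/measurableT_comp => //; apply: measurable_funM => //.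
  exact: measurable_funB.
have G0 (u : Omega * Theta) : (0 <= (G u.1 u.2)%:E)%E by rewrite lee_fin expR_ge0.
pose W w := (\int[P]_theta (G w theta)%:E)%E.
have mW : measurable_fun setT W.
  exact: (measurable_fun_fubini_tonelli_F (fun u => (G u.1 u.2)%:E) mG G0).
have intW : (\int[Pr]_w W w <= f%:E)%E.
  rewrite /W (fubini_tonelli (fun u => (G u.1 u.2)%:E) mG G0)/=.
  apply: (@le_trans _ _ (\int[P]_theta f%:E)%E); last first.
    by rewrite integral_cst//= probability_setT mule1.
  apply: ge0_le_integral => //.
  - by move=> theta _; apply: integral_ge0 => w _; rewrite lee_fin expR_ge0.
  - exact: (measurable_fun_fubini_tonelli_G (fun u => (G u.1 u.2)%:E) mG G0).
  - by move=> theta _; exact: miscoverage_mgf.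
have M01 w theta : 0 <= M w theta <= 1 by exact: miscoverage_itv.
have WE w : (fine (W w))%:E = W w.
  rewrite fineK// ge0_fin_numE; last first.
    by apply: integral_ge0 => theta _; rewrite lee_fin expR_ge0.
  apply: (@le_lt_trans _ _ (\int[P]_theta (expR l)%:E)%E); last first.
    by rewrite integral_cst//= probability_setT mule1 ltry.
  apply: ge0_le_integral => //.
  - by move=> theta _; rewrite lee_fin expR_ge0.
  - have mpair : measurable_fun setT (fun theta : Theta => (w, theta)).
      exact/measurable_fun_pair.
    exact: measurableT_comp mG mpair.
  - move=> theta _; rewrite lee_fin ler_expR ger_pMr//.
    by have /andP[_] := M01 w theta; case/andP: a01; lra.
have mW' : measurable_fun setT (fine \o W) by exact: measurableT_comp.
exists [set w | fine (W w) <= f / delta]; split.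
- exact: measurable_set_le.
- rewrite (_ : [set w | _] = ~` [set w | f / delta < fine (W w)]); last first.
    by apply/seteqP; split=> w /=; rewrite leNgt => /negP.
  have mE : measurable [set w | f / delta < fine (W w)] by exact: measurable_set_lt.
  rewrite probability_setC// -(fineK (fin_num_measure Pr _ mE)) -EFinB lte_fin.
  rewrite ltrD2l ltrN2 -lte_fin fineK ?fin_num_measure//.
  apply: markov_strict => //.
  + by move=> w; rewrite fine_ge0// integral_ge0// => theta _; rewrite lee_fin expR_ge0.
  + exact: divr_gt0.
  + by rewrite divfK ?gt_eqF//; under eq_integral do rewrite WE.
move=> w /= Ew Q KLQ.
have mMw : measurable_fun setT (M w).
  have mpair : measurable_fun setT (fun theta : Theta => (w, theta)).
    exact/measurable_fun_pair.
  exact: measurableT_comp mM mpair.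
have iM : Q.-integrable setT (EFin \o M w).
  apply: measurable_bounded_integrable => //.
    exact: le_lt_trans (probability_le1 Q measurableT) (ltry _).
  exists 1; split; first exact: num_real.
  move=> x x1 theta _ /=; have /andP[M0 M1] := M01 w theta.
  by rewrite ger0_norm// (le_trans M1)// ltW.
pose g theta := l * (M w theta - alpha).
have gE theta : (g theta)%:E =
    (l%:E * (EFin \o M w) theta - (EFin \o cst (l * alpha)%R) theta)%E.
  by rewrite /= -EFinM -EFinB /g mulrBr.
have ilM : Q.-integrable setT (fun theta => l%:E * (EFin \o M w) theta)%E.
  exact: integrableZl.
have ic : Q.-integrable setT (EFin \o cst (l * alpha)%R).
  exact: finite_measure_integrable_cst.
have ig : Q.-integrable setT (EFin \o g).
  rewrite (_ : EFin \o g = fun theta =>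
      (l%:E * (EFin \o M w) theta - (EFin \o cst (l * alpha)%R) theta)%E).
    exact: integrableB.
  by apply/funext => theta; exact: gE.
have fd0 : 0 < f / delta by exact: divr_gt0.
have mg : measurable_fun setT g.
  by apply: measurable_funM => //; exact: measurable_funB.
have PG : (\int[P]_theta (expR (g theta))%:E <= (f / delta)%:E)%E.
  by rewrite -[leLHS]WE lee_fin.
have := le_trans (donsker_varadhan mg ig fd0 PG) KLQ.
under eq_integral do rewrite gE.
rewrite integralB// integralZl//= -(fineK (integrable_fin_num _ iM))//.
rewrite [X in (_ - X + _)%E](_ : _ = (l * alpha)%:E); last first.
  rewrite -[LHS]/(\int[Q]_theta (cst (l * alpha)%:E theta))%E.
  by rewrite integral_cst//= probability_setT mule1.
rewrite -EFinM -!EFinB !lee_fin.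
(* The term [ln (f / delta)] cancels against the bound on [KL], leaving [l * (E_Q[M] - alpha) <=
   0]. *)
rewrite -(invf_div f) lnV ?posrE// lerBlDl subrr subr_le0.
by rewrite ler_pM2l.
Qed.

(** [KL] is nonnegative by [donsker_varadhan] with [g = 0] and [W = 1], whereas a density at least 1
    makes the allowed bound negative. *)
Lemma pac_bayes_vacuous alpha delta (Q : probability Theta R) :
  0 < alpha < 1 -> 0 < delta < 1 -> tilt p q alpha <= 0 ->
  p.+1%:R / (p + q).+2%:R <= alpha ->
  ~ (KL Q P <= (ln (delta / beta_density p q alpha))%:E)%E.
Proof.
move=> a01 /andP[d0 d1] l0 mean_le KLQ.
have := beta_density_ge1 a01 l0 mean_le; set f := beta_density _ _ _ in KLQ * => f1.
have f0 : 0 < f by exact: lt_le_trans f1.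
have : (0 <= KL Q P)%E.
  have := @donsker_varadhan _ _ _ Q P (cst 0) 1.
  rewrite ln1 sube0 integral0; apply => //.
  - exact: finite_measure_integrable_cst.
  - under eq_integral do rewrite /= expR0.
    by rewrite integral_cst//= probability_setT mule1.
move=> /le_trans /(_ KLQ); rewrite lee_fin leNgt => /negP; apply.
by rewrite ln_lt0// divr_gt0//= ltr_pdivrMr// mul1r (lt_le_trans d1).
Qed.
End pac_bayes.

(** * The constants of the statement *)

Section constants.
Context {R : realType}.

(** The lower bound on [N] gives [1 <= k] and [ahat < 1] gives [k <= N]. The ceiling equals
    [N + 1 - k], and the last clause bounds the Beta mean [k / (N + 1)] by [ahat]. *)
Lemma kfloor_split N (ahat : R) : 0 < ahat < 1 -> ahat^-1 - 1 < N%:R ->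
  exists p q, [/\ N = (p + q).+1, kfloor N ahat = p.+1,
    (`|Num.ceil (N.+1%:R * (1 - ahat))|%N).-1 = q &
    p.+1%:R <= N.+1%:R * ahat].
Proof.
move=> /andP[a0 a1] hN; set x := N.+1%:R * ahat.
have x1 : 1 <= x.
  rewrite /x -ler_pdivrMr// mul1r -natr1; lra.
have xN : x < N.+1%:R by rewrite /x gtr_pMr// ltr0n.
have fl1 : (1 <= Num.floor x) by rewrite floor_ge_int.
have [k kE] : exists k, Num.floor x = k.+1%:Z.
  by case: (Num.floor x) fl1 => // -[|k]// _; exists k.
have kx : k.+1%:R <= x by have := floor_le x; rewrite kE.
have kN : (k < N)%N by rewrite -ltnS -(ltr_nat R) (le_lt_trans kx).
exists k, (N - k.+1)%N; split => //.
- by rewrite -addnS -subSn// subSS subnKC// ltnW.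
- by rewrite /kfloor -/x kE.
rewrite mulrBr mulr1 -/x ceilNfloor opprB floorDrz; last first.
  by rewrite rpredN natr_int.
have floorN1 : Num.floor (N.+1%:R : R) = N.+1%:Z by exact: (intrKfloor N.+1%:Z).
rewrite kE floorN ?natr_int// floorN1 opprD opprK.
rewrite addrC subzn// ?subSS//; last exact: ltnW.
by rewrite absz_nat subnS.
Qed.

(** The case [n = 0] is the convention [0 log 0 = 0]: there [x] may vanish. *)
Lemma mulr_ln_div n (x y : R) : ((0 < n)%N -> 0 < x) -> 0 < y ->
  n%:R * ln (x / y) = ln (x ^+ n) - ln (y ^+ n).
Proof.
case: n => [|n] x0 y0; first by rewrite !expr0 ln1 mul0r subrr.
by rewrite ln_div ?posrE ?x0// !lnXn ?x0// mulrBr !mulr_natl.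
Qed.

(** Since [(N - 1) * a = p] and [(N - 1) * (1 - a) = q], the [kl] term is the log-ratio of the Beta
    density at [a] and at [alpha]; [Bconst] is the density at [a] and cancels. *)
Lemma kl_sub_ln_Bconst p q (ahat alpha delta : R) :
  0 < alpha < 1 -> 0 < delta -> (0 < p + q)%N ->
  kfloor (p + q).+1 ahat = p.+1 ->
  ((p + q).+1%:R - 1) * kl (aratio (p + q).+1 ahat) alpha
    - ln (Bconst (p + q).+1 ahat / delta) = ln (delta / beta_density p q alpha).
Proof.
move=> /[dup] a01 /andP[a0 a1] d0 pq0 kE.
have n0 : 0 < (p + q)%:R :> R by rewrite ltr0n.
have aE : aratio (p + q).+1 ahat = p%:R / (p + q)%:R.
  by rewrite /aratio kE -!natr1 !addrK.
rewrite /Bconst kE /= subSS addKn /kl aE.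
set a := p%:R / (p + q)%:R.
have bE : 1 - a = q%:R / (p + q)%:R.
  by rewrite /a natrD; field; rewrite -natrD gt_eqF.
have a_gt0 : (0 < p)%N -> 0 < a by move=> p0; rewrite divr_gt0 ?ltr0n.
have b_gt0 : (0 < q)%N -> 0 < 1 - a by move=> q0; rewrite bE divr_gt0 ?ltr0n.
have ap0 : 0 < a ^+ p by case: (posnP p) => [->|/a_gt0 h]; rewrite ?expr0 ?exprn_gt0.
have bq0 : 0 < (1 - a) ^+ q.
  by case: (posnP q) => [->|/b_gt0 h]; rewrite ?expr0 ?exprn_gt0.
have b0 : 0 < 1 - alpha by rewrite subr_gt0.
have e1 : (p + q)%:R * a = p%:R by rewrite mulrC divfK// gt_eqF.
have e2 : (p + q)%:R * (1 - a) = q%:R by rewrite bE mulrC divfK// gt_eqF.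
have -> : (p + q).+1%:R - 1 = (p + q)%:R :> R by rewrite -natr1 addrK.
rewrite mulrDr [_ * (a * _)]mulrA [_ * ((1 - a) * _)]mulrA e1 e2 !mulr_ln_div//.
have betaV : (p + q).+1`!%:R / (p`!%:R * q`!%:R) = (beta_fun p.+1 q.+1)^-1 :> R.
  by rewrite beta_fun_fact invf_div natrM.
have B0 := @beta_fun_gt0 R p.+1 q.+1.
have Bi0 : 0 < (beta_fun p.+1 q.+1)^-1 :> R by rewrite invr_gt0.
have al0 : 0 < alpha ^+ p by rewrite exprn_gt0.
have be0 : 0 < (1 - alpha) ^+ q by rewrite exprn_gt0.
rewrite betaV !ln_div ?posrE ?beta_density_gt0 ?mulr_gt0//.
rewrite /beta_density !lnM ?posrE ?mulr_gt0// lnV ?posrE//.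
rewrite -[alpha.~]/(1 - alpha).
lra.
Qed.
End constants.

Theorem corollary2p1 (R : realType) (dX dY dO : measure_display)
    (X : measurableType dX) (Y : measurableType dY) (d : nat)
    (D : probability (X * Y)%type R)
    (s : X -> Y -> paramspace R d -> R)
    (ms : measurable_fun [set: (X * Y) * paramspace R d]
            (fun u => s u.1.1 u.1.2 u.2))
    (alpha delta ahat : R)
    (halpha : 0 < alpha < 1) (hdelta : 0 < delta < 1) (hahat : 0 < ahat < 1)
    (hle : ahat <= alpha)
    (P : probability (paramspace R d) R)
    (N : nat) (hN2 : (2 <= N)%N) (hN : ahat^-1 - 1 < N%:R)
    (Omega : measurableType dO) (Pr : probability Omega R)
    (Z : 'I_N -> {RV Pr >-> (X * Y)%type}) (hZ : iid D Z) :
  exists E : set Omega,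
    [/\ measurable E,
        ((1 - delta)%:E < Pr E)%E &
        forall omega, E omega ->
          forall Q : probability (paramspace R d) R,
            (KL Q P <= ((N%:R - 1) * kl (aratio N ahat) alpha
                        - ln (Bconst N ahat / delta))%:E)%E ->
            (Lcov D s [tuple Z i omega | i < N] ahat Q <= alpha%:E)%E].
Proof.
have [p [q [NE kE qE kx]]] := kfloor_split hahat hN.
subst N; have pq0 : (0 < p + q)%N by [].
have [d0 d1] := andP hdelta.
rewrite (kl_sub_ln_Bconst halpha d0 pq0 kE).
have LcovE omega Q : Lcov D s [tuple Z i omega | i < (p + q).+1] ahat Q =
    (\int[Q]_theta (miscoverage D Z (fun z => s z.1 z.2 theta) omega)%:E)%E.
  apply: eq_integral => theta _; rewrite /miscoverage fineK; last first.
    apply: fin_num_measure; apply: measurable_set_lt => //.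
    have mpair : measurable_fun setT (fun z : X * Y => (z, theta)).
      exact/measurable_fun_pair.
    exact: measurableT_comp ms mpair.
  congr (D _); apply/seteqP; split=> z /=;
    rewrite /prediction_set /threshold qE /= ltNge -map_comp => /negP; exact: id.
have [l0|l0] := ltP 0 (tilt p q alpha).
  have [E [mE PE hE]] := pac_bayes ms P hZ halpha d0 l0.
  exists E; split=> // omega Ew Q KLQ.
  by rewrite LcovE; exact: hE.
exists setT; split => //.
  by rewrite [ltRHS]probability_setT lte_fin ltrBlDr ltrDl.
move=> omega _ Q KLQ; exfalso.
apply: (pac_bayes_vacuous halpha hdelta l0 _ KLQ).
(* The Beta mean [k / (N + 1)] is at most [ahat], hence at most [alpha]. *)
by rewrite ler_pdivrMr ?ltr0n// (le_trans kx)// mulrC ler_wpM2r.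
Qed.
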